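(* For all real $q>\frac{1}{2}$, $$\int_{0}^{1}\frac{\left(x^{3q-2}+1\right)\log\left(x^q+1\right)}{x^{3q}+1}\,dx=\frac{1}{36q}\left[\psi'\left(\frac{6 q-1}{6 q}\right)-\psi'\left(\frac{3 q-1}{6 q}\right)\right]+\frac{1}{q}\sum_{n=0}^{\infty}\frac{3^n\,\Gamma\left(n+3-\frac{1}{q}\right)\Gamma\left(n+\frac{1}{q}\right)}{(2n+2)!}\left[\psi(2n+3)-\psi\left(n+3-\frac{1}{q}\right)\right].$$
   Context: $\Gamma$ is the gamma function, $\psi=\Gamma'/\Gamma$ is the digamma function, and $\psi'$ is its derivative. *)

(* Defs.v *)
From mathcomp Require Import all_boot all_order all_algebra.
From mathcomp Require Import all_classical all_reals all_analysis.

Set Implicit Arguments.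
Unset Strict Implicit.
Unset Printing Implicit Defensive.

Import Order.TTheory GRing.Theory Num.Theory.
Import numFieldNormedType.Exports.

Local Open Scope classical_set_scope.
Local Open Scope ring_scope.

(* Euler's integral represents the gamma function for x > 0 only; for x <= 0
   the integral diverges and the values of Gamma, digamma and trigamma are
   meaningless. *)
Definition Gamma (R : realType) (x : R) : R :=
  \int[@lebesgue_measure R]_(t in `]0, +oo[) (t `^ (x - 1) * expR (- t)).

Definition digamma (R : realType) (x : R) : R :=
  derive1 (@Gamma R) x / Gamma x.

Definition trigamma (R : realType) : R -> R := derive1 (@digamma R).

(* If 3 q < 2, the mathematical integrand is undefined at 0, where the library
   puts 0 `^ (3 * q - 2) = 0; a single point is immaterial to the integral. *)
Definition log_integrand (R : realType) (q x : R) : R :=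
  (x `^ (3 * q - 2) + 1) * ln (x `^ q + 1) / (x `^ (3 * q) + 1).

Definition gamma_psi_term (R : realType) (q : R) (n : nat) : R :=
  3 ^+ n * Gamma (n%:R + 3 - 1 / q) * Gamma (n%:R + 1 / q)
  / (2 * n + 2)`!%:R
  * (digamma (2 * n%:R + 3) - digamma (n%:R + 3 - 1 / q)).

(* Main.v *)
(* With [s = 1 / q] and [t = x ^ q], the left-hand side is [s] times the
   integral over ]0, 1] of [(t^(2-s) + t^(s-1)) ln(1+t) / (1+t^3)].  The
   inversion [t -> 1/t] rewrites the first summand as the tail over [1, +oo[
   of the second, up to [t^(2-s) ln t / (1+t^3)].  Two integrals remain.

   Since [1 + t^3 = (1+t)^3 (1 - 3t/(1+t)^2)], the one over ]0, +oo[ is the sum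
   of [3^n] times the integrals of [t^(n+s-1) ln(1+t) (1+t)^(-2n-3)]; each of
   these is minus the derivative in [w], at [w = 2n+3], of the beta integral of
   [t^(b-1) (1+t)^(-w)], equal to [Gamma b * Gamma (w-b) / Gamma w].

   The other one is the derivative of [F a], the integral over ]0, 1] of
   [t^(a-1) / (1+t^3)].  Both [F] and
   [D a = (digamma ((a+3)/6) - digamma (a/6)) / 6] satisfy
   [X a + X (a+3) = 1/a] with [X >= 0]; hence [F - D] changes sign under
   translation by 3 and is bounded by [1/a], so it vanishes. *)
Require Import Defs.
From mathcomp Require Import all_boot all_order all_algebra.
From mathcomp Require Import all_classical all_reals all_analysis.
From mathcomp Require Import measurable_realfun ring lra.

Set Implicit Arguments.
Unset Strict Implicit.
Unset Printing Implicit Defensive.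

Import Order.TTheory GRing.Theory Num.Theory.
Import numFieldNormedType.Exports.

Local Open Scope classical_set_scope.
Local Open Scope ring_scope.

(** * Differentiation of exponential moments *)

(** For a nonnegative function a finite integral is integrability, so each closed form computed
    below in the extended reals also delivers the integrability of its integrand. *)
Lemma ge0_integrable_fin d (T : measurableType d) (R : realType)
    (mu : {measure set T -> \bar R}) (D : set T) (f : T -> R) (r : R) :
  measurable D -> measurable_fun D f -> (forall t, D t -> 0 <= f t) ->
  (\int[mu]_(t in D) (f t)%:E = r%:E)%E -> mu.-integrable D (EFin \o f).
Proof.
move=> mD mf f0 fr; apply/integrableP; split; first exact/measurable_EFinP.
rewrite (eq_integral (fun t => (f t)%:E)) ?fr ?ltry// => t /set_mem Dt.
by rewrite gee0_abs// lee_fin f0.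
Qed.

Lemma integrable_EFin_Rintegral d (T : measurableType d) (R : realType)
    (mu : {measure set T -> \bar R}) (D : set T) (f : T -> R) :
  measurable D -> mu.-integrable D (EFin \o f) ->
  (\int[mu]_(t in D) (f t)%:E = (\int[mu]_(t in D) f t)%:E)%E.
Proof. by move=> mD fi; rewrite /Rintegral fineK// integrable_fin_num. Qed.

Section moment.
Context d (T : measurableType d) (R : realType).
Variables (mu : {measure set T -> \bar R}) (D : set T) (L h : T -> R) (u v : R).
Hypothesis mD : measurable D.
Hypothesis mL : measurable_fun D L.
Hypothesis integrable_expRM : forall x, u < x < v ->
  mu.-integrable D (EFin \o (fun t => expR (x * L t) * h t)).

(* For [delta = e / 2]: [|L| <= expR (delta * |L|) / delta], and the exponent
   [x * L + delta * |L|] stays below one of [(x0 + e) * L], [(x0 - e) * L]. *)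
Lemma norm_expRM_le (x0 x e l : R) : 0 < e -> `|x - x0| <= e / 2 ->
  `|l| * expR (x * l) <=
  2 / e * (expR ((x0 + e) * l) + expR ((x0 - e) * l)).
Proof.
move=> e0 xx0.
have e20 : 0 < e / 2 by rewrite divr_gt0.
have h1 : `|l| <= 2 / e * expR (e / 2 * `|l|).
  have := expR_ge1Dx (e / 2 * `|l|) => hh.
  rewrite -[X in X <= _](_ : 2 / e * (e / 2 * `|l|) = `|l|); last first.
    by field; rewrite gt_eqF.
  by rewrite ler_pM2l ?divr_gt0// (le_trans _ hh)// lerDr.
apply: (@le_trans _ _ (2 / e * expR (e / 2 * `|l|) * expR (x * l))).
  by rewrite ler_wpM2r ?expR_ge0.
rewrite -mulrA ler_pM2l ?divr_gt0// -expRD.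
have hle : (x - x0) * l <= e / 2 * `|l|.
  by rewrite (le_trans (ler_norm _))// normrM ler_wpM2r.
have [l0|l0] := leP 0 l.
  rewrite -[leLHS]addr0 lerD ?expR_ge0// ler_expR.
  by move: hle; rewrite ger0_norm//; lra.
rewrite -[leLHS]add0r lerD ?expR_ge0// ler_expR.
by move: hle; rewrite ltr0_norm//; lra.
Qed.

Lemma near_itv_radius (x : R) : u < x < v ->
  exists2 e, 0 < e & u < x - e /\ x + e < v.
Proof.
move=> /andP[ux xv]; exists (Num.min (x - u) (v - x) / 2).
  by rewrite divr_gt0// lt_min !subr_gt0 ux.
have := ge_min (x - u) (x - u) (v - x); rewrite lexx /= => m1.
have := ge_min (v - x) (x - u) (v - x); rewrite lexx orbT => m2.
by split; lra.
Qed.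

(** Majorant of the derivative in the parameter, uniform over distance at most [e / 2] from [x]. It
    is integrable because [x - e] and [x + e] still lie in []u, v[]. *)
Let G (x e : R) t := 2 / e *
  (`|expR ((x + e) * L t) * h t| + `|expR ((x - e) * L t) * h t|).

Let G_ge0 x e t : 0 < e -> 0 <= G x e t.
Proof. by move=> e0; rewrite mulr_ge0 ?addr_ge0// divr_ge0// ltW. Qed.

Let integrable_G x e : 0 < e -> u < x - e -> x + e < v ->
  mu.-integrable D (EFin \o G x e).
Proof.
move=> e0 ux xv.
have i1 : mu.-integrable D (EFin \o (fun t => expR ((x + e) * L t) * h t)).
  by apply: integrable_expRM; lra.
have i2 : mu.-integrable D (EFin \o (fun t => expR ((x - e) * L t) * h t)).
  by apply: integrable_expRM; lra.
rewrite /G /comp; under eq_fun do rewrite EFinM EFinD.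
apply: integrableZl => //; apply: integrableD => //.
  exact: (integrable_norm i1).
exact: (integrable_norm i2).
Qed.

Let le_G x y e t : 0 < e -> `|y - x| <= e / 2 ->
  `|expR (y * L t) * (L t * h t)| <= G x e t.
Proof.
move=> e0 yx; rewrite /G !normrM !(ger0_norm (expR_ge0 _)) -mulrDl.
by rewrite mulrA [X in X * _]mulrC mulrA ler_wpM2r// norm_expRM_le.
Qed.

(** The conclusion has the shape of the section's integrability hypothesis with [h] replaced by
    [L * h], so it can be iterated to reach higher derivatives. *)
Lemma integrable_expRM_mul (x : R) : u < x < v ->
  mu.-integrable D (EFin \o (fun t => expR (x * L t) * (L t * h t))).
Proof.
move=> ux; have [e e0 [ux' xv']] := near_itv_radius ux.
apply: le_integrable (integrable_G e0 ux' xv') => //.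
  apply/measurable_EFinP; rewrite [X in measurable_fun _ X](_ : _ =
    (fun t => L t * (expR (x * L t) * h t))); last first.
    by apply/funext => t; rewrite mulrCA.
  apply: measurable_funM => //.
  exact/measurable_EFinP/(measurable_int mu (integrable_expRM ux)).
move=> t Dt; rewrite lee_fin [leRHS]ger0_norm ?G_ge0//.
by apply: le_G => //; rewrite subrr normr0 divr_ge0// ltW.
Qed.

(** Dominated differentiation with majorant [G]. The exponential form covers every parameter used
    later: [L = ln t] for Mellin integrals, [L = - t] for Laplace integrals and [L = - ln (1 + u)]
    for beta integrals. *)
Lemma is_derive_integral_expRM (x : R) : u < x < v ->
  is_derive x 1 (fun y => \int[mu]_(t in D) (expR (y * L t) * h t))
   (\int[mu]_(t in D) (expR (x * L t) * (L t * h t))).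
Proof.
move=> ux; have [e e0 [ux' xv']] := near_itv_radius ux.
pose f y t := expR (y * L t) * h t.
have df (y : R) t : is_derive y 1 (f ^~ t) (expR (y * L t) * (L t * h t)).
  rewrite /f; apply: is_derive_eq.
  by rewrite scaler0 add0r /= !scaler1 /GRing.scale/=; ring.
have d1f y t : partial1of2 f y t = expR (y * L t) * (L t * h t).
  by rewrite partial1of2E; exact: derive_val.
have Ix : `]x - e / 2, x + e / 2[%classic x by rewrite /= in_itv/=; lra.
have intf y : `]x - e / 2, x + e / 2[%classic y -> mu.-integrable D (EFin \o f y).
  by rewrite /= in_itv/= => hy; apply: integrable_expRM; lra.
have derf y t : `]x - e / 2, x + e / 2[%classic y -> D t -> derivable (f ^~ t) y 1.
  by move=> _ _; exact: ex_derive.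
have G0 t : 0 <= G x e t by exact: G_ge0.
have Gub y t : `]x - e / 2, x + e / 2[%classic y -> D t -> `|partial1of2 f y t| <= G x e t.
  rewrite /= in_itv/= => hy _; rewrite d1f le_G// ler_norml; lra.
have iG := integrable_G e0 ux' xv'.
apply: DeriveDef.
  exact: (derivable_under_integral mD Ix intf derf G0 iG Gub).
rewrite -derive1E.
rewrite (differentiation_under_integral mD Ix intf derf G0 iG Gub).
by apply: eq_Rintegral => t _; rewrite d1f.
Qed.

End moment.

(** * Changes of variables on the positive half-line *)

(** Monotone convergence along two exhaustions: equalities on compact pieces pass to the unions,
    which may be unbounded or touch a singularity. *)
Lemma eq_integral_bigcup d (T : measurableType d) (R : realType)
    (mu : {measure set T -> \bar R}) (A B : (set T)^nat) (f g : T -> \bar R) :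
  nondecreasing_seq A -> nondecreasing_seq B ->
  (forall n, measurable (A n)) -> (forall n, measurable (B n)) ->
  (forall n, measurable_fun (A n) f) -> (forall n, measurable_fun (B n) g) ->
  (forall n t, A n t -> 0 <= f t)%E -> (forall n t, B n t -> 0 <= g t)%E ->
  (forall n, \int[mu]_(t in A n) f t = \int[mu]_(t in B n) g t)%E ->
  (\int[mu]_(t in \bigcup_n A n) f t = \int[mu]_(t in \bigcup_n B n) g t)%E.
Proof.
move=> ndA ndB mA mB mf mg f0 g0 fg.
have cf := @ge0_nondecreasing_set_cvg_integral _ _ _ _ _ mu ndA mA mf f0.
have := @ge0_nondecreasing_set_cvg_integral _ _ _ _ _ mu ndB mB mg g0.
by rewrite -(funext fg) => cg; exact: cvg_unique cf cg.
Qed.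

Lemma continuous_at_powR {R : realType} (p x : R) : 0 < x ->
  continuous_at x (@powR R ^~ p).
Proof.
move=> x0; apply/differentiable_continuous/derivable1_diffP.
by apply: derivable_powR; rewrite in_itv/= x0.
Qed.

Section substitution.
Context {R : realType}.
Local Notation mu := (@lebesgue_measure R).
Variables (F f G : R -> R) (a b : R^nat).
Hypothesis nia : nonincreasing_seq a.
Hypothesis ndb : nondecreasing_seq b.
Hypothesis a0 : forall n, 0 < a n.
Hypothesis ab : forall n, a n <= b n.
Hypothesis F0 : forall x, 0 < x -> 0 < F x.
Hypothesis dF : forall x : R, 0 < x -> is_derive x (1:R) F (f x).
Hypothesis cf : forall x : R, 0 < x -> continuous_at x f.
Hypothesis cG : forall x : R, 0 < x -> continuous_at x G.
Hypothesis G0 : forall x, 0 < x -> 0 <= G x.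

Let dFE (x : R) : 0 < x -> derive1 F x = f x.
Proof. by move=> x0; rewrite derive1E; apply: derive_val; exact: dF. Qed.

Let cdF (x : R) : 0 < x -> continuous_at x (derive1 F).
Proof.
move=> x0; rewrite /continuous_at dFE//.
apply: (cvg_trans _ (cf x0)); apply: near_eq_cvg.
by near=> y; rewrite dFE//; near: y; exact: lt_nbhsr.
Unshelve. all: end_near. Qed.

Let cF (x : R) : 0 < x -> continuous_at x F.
Proof.
move=> x0; apply/differentiable_continuous/derivable1_diffP.
by apply: ex_derive; exact: dF.
Qed.

Let within_itv (h : R -> R) (x y : R) : 0 < x ->
  (forall z : R, 0 < z -> continuous_at z h) ->
  {within `[x, y]%classic, continuous h}.
Proof.
move=> x0 ch; apply: continuous_in_subspaceT => z; rewrite inE/= in_itv/=.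
by move=> /andP[xz _]; apply: ch; exact: lt_le_trans xz.
Qed.

Let itv_gt0 (x y z : R) : 0 < x -> `[x, y]%classic z -> 0 < z.
Proof. by move=> x0 /=; rewrite in_itv/= => /andP[+ _]; exact: lt_le_trans. Qed.

Let LR (x y : R) : 0 < x -> x <= y -> derivable_oo_LRcontinuous F x y.
Proof.
move=> x0 xy; split.
- move=> z; rewrite in_itv/= => /andP[xz _]; apply: ex_derive; apply: dF.
  exact: lt_trans xz.
- exact/cvg_at_right_filter/cF.
- by apply/cvg_at_left_filter/cF; exact: lt_le_trans xy.
Qed.

Let measurable_itv (h : R -> R) (x y : R) : 0 < x ->
  (forall z : R, 0 < z -> continuous_at z h) ->
  measurable_fun `[x, y] (EFin \o h).
Proof.
move=> x0 ch; apply/measurable_EFinP.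
apply: subspace_continuous_measurable_fun => //.
exact: within_itv.
Qed.

Let nd_itv (u v : R^nat) : nonincreasing_seq u -> nondecreasing_seq v ->
  nondecreasing_seq (fun n => `[u n, v n]%classic).
Proof.
move=> niu ndv m n mn; apply/subsetPset => z /=; rewrite !in_itv/= => /andP[uz zv].
by rewrite (le_trans (niu _ _ mn) uz) (le_trans zv (ndv _ _ mn)).
Qed.

Let b0 n : 0 < b n. Proof. exact: lt_le_trans (ab n). Qed.

(** The factor [k] is [1] for increasing and [-1] for decreasing substitutions. *)
Let cGFf (k : R) (x : R) : 0 < x -> continuous_at x (fun t => G (F t) * (k * f t)).
Proof.
move=> x0; apply: cvgM; last by apply: cvgM; [exact: cvg_cst|exact: cf].
by apply: continuous_comp; [exact: cF|apply/cG/F0].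
Qed.

(** The substitution is made on each compact [[a n, b n]] inside the open half-line, where
    everything is continuous; [eq_integral_bigcup] then takes the union. *)
Lemma ge0_integration_by_substitution_increasing_bigcup :
  (forall x y, 0 < x -> x < y -> F x < F y) ->
  (forall x, 0 < x -> 0 <= f x) ->
  (\int[mu]_(t in \bigcup_n `[F (a n), F (b n)]%classic) (G t)%:E =
   \int[mu]_(t in \bigcup_n `[a n, b n]%classic) (G (F t) * f t)%:E)%E.
Proof.
move=> incF f0.
have incF' x y : 0 < x -> x <= y -> F x <= F y.
  by move=> x0; rewrite le_eqVlt => /predU1P[->//|xy]; exact/ltW/incF.
have mGf n : measurable_fun `[a n, b n] (EFin \o (fun t => G (F t) * f t)).
  apply: measurable_itv => // x x0.
  by under eq_fun do rewrite -[f _]mul1r; exact: cGFf.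
apply: eq_integral_bigcup => //.
- apply: nd_itv => m n mn; apply: incF' => //; [exact: nia|exact: ndb].
- exact: nd_itv.
- by move=> n; apply: measurable_itv => //; exact: F0.
- by move=> n t ht; rewrite lee_fin G0// (itv_gt0 _ ht)// F0.
- move=> n t /itv_gt0-/(_ (a0 n)) t0.
  by rewrite lee_fin mulr_ge0 ?f0 ?G0 ?F0.
move=> n; rewrite (@integration_by_substitution_increasing _ F G)//; first last.
- by apply: within_itv => //; exact: F0.
- exact: LR.
- by apply/cvg_ex; exists (derive1 F (b n)); exact/cvg_at_left_filter/cdF.
- by apply/cvg_ex; exists (derive1 F (a n)); exact/cvg_at_right_filter/cdF.
- move=> x; rewrite in_itv/= => /andP[ax _]; apply: cdF; exact: lt_trans ax.
- move=> x y; rewrite !in_itv/= => /andP[ax _] _ xy; apply: incF => //.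
  exact: lt_le_trans ax.
by apply: eq_integral => x /set_mem/itv_gt0-/(_ (a0 n)) x0 /=; rewrite !fctE/= dFE.
Qed.

Lemma ge0_integration_by_substitution_decreasing_bigcup :
  (forall x y, 0 < x -> x < y -> F y < F x) ->
  (forall x, 0 < x -> f x <= 0) ->
  (\int[mu]_(t in \bigcup_n `[F (b n), F (a n)]%classic) (G t)%:E =
   \int[mu]_(t in \bigcup_n `[a n, b n]%classic) (G (F t) * - f t)%:E)%E.
Proof.
move=> decF f0.
have decF' x y : 0 < x -> x <= y -> F y <= F x.
  by move=> x0; rewrite le_eqVlt => /predU1P[->//|xy]; exact/ltW/decF.
have mGf n : measurable_fun `[a n, b n] (EFin \o (fun t => G (F t) * - f t)).
  apply: measurable_itv => // x x0.
  by under eq_fun do rewrite -mulN1r; exact: cGFf.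
apply: eq_integral_bigcup => //.
- apply: nd_itv => m n mn; apply: decF' => //; [exact: ndb|exact: nia].
- exact: nd_itv.
- by move=> n; apply: measurable_itv => //; exact: F0.
- by move=> n t ht; rewrite lee_fin G0// (itv_gt0 _ ht)// F0.
- move=> n t /itv_gt0-/(_ (a0 n)) t0.
  by rewrite lee_fin mulr_ge0 ?oppr_ge0 ?f0 ?G0 ?F0.
move=> n; rewrite (@integration_by_substitution_decreasing _ F G)//; first last.
- by apply: within_itv => //; exact: F0.
- exact: LR.
- by apply/cvg_ex; exists (derive1 F (b n)); exact/cvg_at_left_filter/cdF.
- by apply/cvg_ex; exists (derive1 F (a n)); exact/cvg_at_right_filter/cdF.
- move=> x; rewrite in_itv/= => /andP[ax _]; apply: cdF; exact: lt_trans ax.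
- move=> x y; rewrite !in_itv/= => _ /andP[ay _] xy; apply: decF => //.
  exact: lt_le_trans ay.
by apply: eq_integral => x /set_mem/itv_gt0-/(_ (a0 n)) x0 /=; rewrite !fctE/= dFE.
Qed.

End substitution.

(** * Scaling, powers and inversion as changes of variables *)

Section substitution_instances.
Context {R : realType}.
Local Notation mu := (@lebesgue_measure R).
Variable G : R -> R.
Hypothesis cG : forall x : R, 0 < x -> continuous_at x G.
Hypothesis G0 : forall x, 0 < x -> 0 <= G x.

Let a n : R := n.+1%:R^-1.
Let b n : R := n.+1%:R.

Let a0 n : 0 < a n. Proof. by rewrite invr_gt0 ltr0n. Qed.

Let nia : nonincreasing_seq a.
Proof. by move=> m n mn; rewrite /a lef_pV2 ?posrE ?ltr0n// ler_nat. Qed.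

Let ndb : nondecreasing_seq b.
Proof. by move=> m n mn; rewrite /b ler_nat. Qed.

Let a1 n : a n <= 1.
Proof. by rewrite /a invf_le1 ?ltr0n// ler1n. Qed.

Let b1 n : 1 <= b n. Proof. by rewrite ler1n. Qed.

Lemma bigcup_itv_harmonic_bndy (c : R) : 0 < c ->
  \bigcup_n `[c * n.+1%:R^-1, c * n.+1%:R]%classic = `]0, +oo[%classic.
Proof.
move=> c0; apply/seteqP; split => x /=.
  move=> [n _ /=]; rewrite !in_itv/= andbT => /andP[+ _].
  by apply: lt_le_trans; rewrite mulr_gt0.
rewrite in_itv/= andbT => x0.
(* The upper bound on [x] asks for an index above [x / c], the lower bound for one above [c / x];
   their sum dominates both. *)
exists (Num.Def.archi_bound (x / c + c / x)) => //=.
set N := Num.Def.archi_bound _.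
have hN : x / c + c / x < N.+1%:R.
  rewrite (@lt_trans _ _ N%:R) ?ltr_nat//.
  by apply: archi_boundP; rewrite addr_ge0 ?divr_ge0// ltW.
have xc : 0 < x / c by rewrite divr_gt0.
have cx : 0 < c / x by rewrite divr_gt0.
rewrite in_itv/=; apply/andP; split.
  rewrite ler_pdivrMr ?ltr0n// mulrC -ler_pdivrMr//; lra.
rewrite mulrC -ler_pdivrMr//; lra.
Qed.

Lemma ge0_integral_scale (c : R) : 0 < c ->
  (\int[mu]_(t in `]0%R, +oo[) (G t)%:E =
   \int[mu]_(t in `]0%R, +oo[) (G (c * t) * c)%:E)%E.
Proof.
move=> c0; rewrite -{1}(@bigcup_itv_harmonic_bndy c)//.
have -> : `]0, +oo[%classic = \bigcup_n `[a n, b n]%classic.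
  rewrite -(@bigcup_itv_harmonic_bndy 1)//.
  by apply: eq_bigcupr => n _; rewrite !mul1r.
apply: (@ge0_integration_by_substitution_increasing_bigcup _ (fun t => c * t) (fun=> c) G a b) => //.
- by move=> n; exact: le_trans (b1 n).
- by move=> x x0; rewrite mulr_gt0.
- by move=> x _; apply: is_derive_eq; rewrite /GRing.scale/=; ring.
- by move=> x _; exact: cvg_cst.
- by move=> x y _; rewrite ltr_pM2l.
- by move=> x _; exact: ltW.
Qed.

Lemma ge0_integral_powR (p : R) : 0 < p ->
  (\int[mu]_(t in `]0%R, 1%R]) (G t)%:E =
   \int[mu]_(t in `]0%R, 1%R]) (G (t `^ p) * (p * t `^ (p - 1)))%:E)%E.
Proof.
move=> p0.
(* The images of [[a n, 1]] under the power [r] exhaust []0, 1]]. The case [r = p] serves the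
   left-hand side and [r = 1] the right-hand side. *)
have e (r : R) : 0 < r ->
    \bigcup_n `[(a n) `^ r, 1 `^ r]%classic = `]0, 1]%classic.
  move=> r0; apply/seteqP; split => x /=.
    move=> [n _ /=]; rewrite !in_itv/= powR1 => /andP[+ ->]; rewrite andbT.
    by apply: lt_le_trans; rewrite powR_gt0.
  rewrite in_itv/= => /andP[x0 x1].
  have y0 : 0 < x `^ r^-1 by rewrite powR_gt0.
  exists (Num.Def.archi_bound (x `^ r^-1)^-1) => //=.
  set N := Num.Def.archi_bound _.
  have hN : (x `^ r^-1)^-1 < N.+1%:R.
    rewrite (@lt_trans _ _ N%:R) ?ltr_nat//.
    by apply: archi_boundP; rewrite invr_ge0 ltW.
  rewrite in_itv/= powR1 x1 andbT.
  rewrite -[leRHS](powRr1 (ltW x0)) -(mulVf (lt0r_neq0 r0)) powRrM.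
  apply: ge0_ler_powR; rewrite ?nnegrE ?ltW//.
  by rewrite -ltf_pV2 ?posrE// invrK.
have e1 : `]0, 1]%classic = \bigcup_n `[a n, 1]%classic.
  by rewrite -(e 1)//; apply: eq_bigcupr => n _; rewrite !powRr1 ?ltW.
rewrite -{1}(e p)// e1.
apply: (@ge0_integration_by_substitution_increasing_bigcup _ (@powR R ^~ p)
  (fun t => p * t `^ (p - 1)) G a (fun=> 1)) => //.
- by move=> x x0; rewrite powR_gt0.
- move=> x x0; apply: cvgM; first exact: cvg_cst.
  exact: continuous_at_powR.
- move=> x y x0 xy; apply: gt0_ltr_powR => //; rewrite nnegrE ltW//.
  exact: lt_trans xy.
- by move=> x x0; rewrite mulr_ge0 ?powR_ge0// ltW.
Qed.

Lemma ge0_integral_inv :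
  (\int[mu]_(t in `[1%R, +oo[) (G t)%:E =
   \int[mu]_(t in `]0%R, 1%R]) (G t^-1 * t ^- 2)%:E)%E.
Proof.
have -> : `[1, +oo[%classic = \bigcup_n `[1^-1, (a n)^-1]%classic.
  apply/seteqP; split => x /=.
    rewrite in_itv/= andbT => x1; exists (Num.Def.archi_bound x) => //=.
    rewrite in_itv/= invr1 x1 /a invrK ltW// (@lt_trans _ _ (Num.Def.archi_bound x)%:R) ?ltr_nat//.
    by apply: archi_boundP; rewrite (le_trans _ x1).
  by move=> [n _ /=]; rewrite !in_itv/= invr1 => /andP[->].
have -> : `]0, 1]%classic = \bigcup_n `[a n, 1]%classic.
  apply/seteqP; split => x /=.
    rewrite in_itv/= => /andP[x0 x1]; exists (Num.Def.archi_bound x^-1) => //=.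
    rewrite in_itv/= x1 andbT -lef_pV2 ?posrE// /a invrK ltW//.
    rewrite (@lt_trans _ _ (Num.Def.archi_bound x^-1)%:R) ?ltr_nat//.
    by apply: archi_boundP; rewrite invr_ge0 ltW.
  by move=> [n _ /=]; rewrite !in_itv/= => /andP[+ ->]; rewrite andbT; apply: lt_le_trans.
have dinv (x : R) : 0 < x -> is_derive x (1:R) (@GRing.inv R) (- x ^- 2).
  move=> x0; apply: is_derive_eq; first by apply: is_deriveV; rewrite gt_eqF.
  by rewrite /GRing.scale/= mulr1.
(* The decreasing rule carries the Jacobian as [- f]; here [f] is [- t ^- 2]. *)
under [RHS]eq_integral => t _ do rewrite -[t ^- 2]opprK.
apply: (@ge0_integration_by_substitution_decreasing_bigcup _ (@GRing.inv R)
  (fun t => - t ^- 2) G a (fun=> 1)) => //.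
- by move=> x x0; rewrite invr_gt0.
- move=> x x0; apply: cvgN; apply: cvgV; first by rewrite expf_neq0// gt_eqF.
  exact: exprn_continuous.
- by move=> x y x0 xy; rewrite ltf_pV2// posrE// (lt_trans x0).
- by move=> x x0; rewrite oppr_le0 invr_ge0 exprn_ge0// ltW.
Qed.

End substitution_instances.

(** * The gamma function *)

Local Notation Rpos := (`]0%R, +oo[%classic : set (Real.sort _)) (only parsing).
Local Notation Runit := (`]0%R, 1%R]%classic : set (Real.sort _)) (only parsing).

Section continuity.
Context {R : realType}.
Implicit Types x : R.

Lemma continuous_at_expRM (c x : R) : continuous_at x (fun t => expR (c * t)).
Proof.
apply: (@continuous_comp _ _ _ ( *%R c) expR); last exact: continuous_expR.
by apply: cvgM; [exact: cvg_cst|exact: cvg_id].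
Qed.

Lemma measurable_fun_gt0 (D : set R) (f : R -> R) : measurable D ->
  D `<=` `]0, +oo[ -> (forall x, 0 < x -> continuous_at x f) ->
  measurable_fun D f.
Proof.
move=> mD D0 cf; suff : measurable_fun Rpos f by exact: measurable_funS.
apply: open_continuous_measurable_fun; first exact: interval_open.
by move=> x; rewrite inE/= in_itv/= andbT; exact: cf.
Qed.

End continuity.

(** * Euler's integral: convergence, positivity and scaling *)

Section gamma_integrable.
Context {R : realType}.
Local Notation mu := (@lebesgue_measure R).

(** The substitution by the power [a] in the integral of the constant [1] gives [1 = a * I], with
    [I] the integral sought. *)
Lemma integral_powR_itv01 (a : R) : 0 < a ->
  (\int[mu]_(t in `]0%R, 1%R]) (t `^ (a - 1))%:E = (a^-1)%:E)%E.
Proof.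
move=> a0.
have c1 (x : R) : 0 < x -> continuous_at x (cst (1 : R)) by move=> _; exact: cvg_cst.
have I1 : (\int[mu]_(t in `]0%R, 1%R]) (cst (1 : R) t)%:E = 1%:E)%E.
  transitivity (\int[mu]_(t in `]0%R, 1%R]) (cst 1%E t))%E; first exact: eq_integral.
  by rewrite integral_cst//= lebesgue_measure_itv/= lte_fin ltr01 oppr0 adde0 mule1.
have := ge0_integral_powR c1 (fun _ _ => ler01) a0.
rewrite I1.
under eq_integral do rewrite mul1r EFinM.
rewrite ge0_integralZl//=; last 3 first.
- by apply/measurable_EFinP/measurable_funTS; exact: measurable_powR.
- by move=> x _; rewrite lee_fin powR_ge0.
- by rewrite lee_fin ltW.
move=> h; have <- : ((a^-1)%:E * (a%:E * \int[mu]_(t in `]0%R, 1%R]) (t `^ (a - 1))%:E) =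
  \int[mu]_(t in `]0%R, 1%R]) (t `^ (a - 1))%:E)%E.
  by rewrite muleA -EFinM mulVf ?mul1e// gt_eqF.
by rewrite -h mule1.
Qed.

Lemma integral_expRN (c : R) : 0 < c ->
  (\int[mu]_(t in `]0%R, +oo[) (c * expR (- c * t))%:E = 1%:E)%E.
Proof.
move=> c0; rewrite integral_itv_obnd_cbnd; last first.
  apply/measurable_EFinP; apply: measurable_fun_gt0 => // x _.
  by apply: cvgM; [exact: cvg_cst|exact: continuous_at_expRM].
rewrite -(integral_exponential_pdf c0) [LHS]integral_mkcond.
by apply: eq_integral => x _; rewrite /exponential_pdf !patchE; case: ifP.
Qed.

(** For [t >= 1] the power is at most [t ^+ N.+1], which is a multiple of one term of the
    exponential series at [t / 2]. The rate [1 / 2] leaves a factor [expR (- t / 2)] for the tail of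
    Euler's integral. *)
Lemma powR_le_expR (a : R) : exists2 C, 0 <= C &
  forall t : R, 1 <= t -> t `^ a <= C * expR (2^-1 * t).
Proof.
pose N := Num.Def.archi_bound `|a|.
have aN : a <= N.+1%:R.
  rewrite (le_trans (ler_norm _))// ltW// (@lt_trans _ _ N%:R) ?ltr_nat//.
  exact: archi_boundP.
exists (2 ^+ N.+1 * N.+1`!%:R) => [|t t1].
  by rewrite mulr_ge0 ?exprn_ge0.
have t0 : 0 <= t by rewrite (le_trans _ t1).
apply: (@le_trans _ _ (t ^+ N.+1)).
  by rewrite -powR_mulrn//; exact: ler_powR.
have t20 : 0 <= 2^-1 * t by rewrite mulr_ge0.
have := @expR_ge1Dxn _ (2^-1 * t) N t20 => h.
rewrite (_ : t ^+ N.+1 = 2 ^+ N.+1 * N.+1`!%:R * ((2^-1 * t) ^+ N.+1 / N.+1`!%:R)).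
  apply: ler_wpM2l; first by rewrite mulr_ge0 ?exprn_ge0.
  by apply: le_trans h; rewrite lerDr.
rewrite exprMn exprVn; field.
by rewrite expf_neq0//= pnatr_eq0 -lt0n fact_gt0.
Qed.

Lemma continuous_at_Gamma_integrand (x c t : R) : 0 < t ->
  continuous_at t (fun t => t `^ (x - 1) * expR (c * t)).
Proof.
by move=> t0; apply: cvgM; [exact: continuous_at_powR|exact: continuous_at_expRM].
Qed.

Lemma continuous_at_Gamma_integrand1 (x t : R) : 0 < t ->
  continuous_at t (fun t => t `^ (x - 1) * expR (- t)).
Proof.
move=> t0; apply: cvgM; first exact: continuous_at_powR.
apply: (@continuous_comp _ _ _ -%R expR); last exact: continuous_expR.
exact: opp_continuous.
Qed.

Lemma integrable_Gamma (x : R) : 0 < x ->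
  mu.-integrable `]0, +oo[ (EFin \o (fun t => t `^ (x - 1) * expR (- t))).
Proof.
move=> x0.
have mG : measurable_fun Rpos (fun t : R => t `^ (x - 1) * expR (- t)).
  apply: measurable_fun_gt0 => // t t0.
  exact: continuous_at_Gamma_integrand1.
apply/integrableP; split; first exact/measurable_EFinP.
have ge0 (t : R) : 0 <= t `^ (x - 1) * expR (- t).
  by rewrite mulr_ge0 ?powR_ge0 ?expR_ge0.
under eq_integral do rewrite gee0_abs ?lee_fin ?ge0//.
have -> : `]0, +oo[%classic = `]0, 1] `|` `]1, +oo[ :> set R.
  by rewrite -itv_bndbnd_setU// bnd_simp.
rewrite ge0_integral_setU//=; last 3 first.
- apply/measurable_EFinP; rewrite -itv_bndbnd_setU// bnd_simp//.
- by move=> t _; rewrite lee_fin.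
- apply/disj_setPS => t /=; rewrite !in_itv/= => -[/andP[_ t1] /andP[]].
  by rewrite ltNge t1.
have m1 : measurable_fun Runit (fun t : R => t `^ (x - 1) * expR (- t)).
  by apply: measurable_funS mG => // t/=; rewrite !in_itv/= => /andP[->].
have m2 : measurable_fun (`]1, +oo[ : set R) (fun t : R => t `^ (x - 1) * expR (- t)).
  apply: measurable_funS mG => // t/=; rewrite !in_itv/= !andbT.
  exact: lt_trans.
apply: lte_add_pinfty.
  apply: (@le_lt_trans _ _ (\int[mu]_(t in `]0%R, 1%R]) (t `^ (x - 1))%:E)%E).
    apply: ge0_le_integral => //.
    - by move=> t _; rewrite lee_fin.
    - exact/measurable_EFinP.
    - by apply/measurable_EFinP/measurable_funTS; exact: measurable_powR.
    - move=> t /=; rewrite in_itv/= => /andP[t0 _].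
      by rewrite lee_fin ler_piMr ?powR_ge0// expR_le1 oppr_le0 ltW.
  by rewrite integral_powR_itv01// ltry.
have [C C0 hC] := powR_le_expR (x - 1).
have mE D : measurable_fun D (fun t : R => 2^-1 * expR (- 2^-1 * t)).
  apply: measurable_funTS; apply: continuous_measurable_fun => t.
  by apply: cvgM; [exact: cvg_cst|exact: continuous_at_expRM].
(* The factor 2 offsets the normalisation [2^-1] of the exponential density of rate [2^-1], whose
   total mass is 1. *)
apply: (@le_lt_trans _ _ (\int[mu]_(t in `]1%R, +oo[) ((2 * C)%:E * (2^-1 * expR (- 2^-1 * t))%:E))%E).
  apply: ge0_le_integral => //.
  - by move=> t _; rewrite lee_fin.
  - exact/measurable_EFinP.
  - by apply: measurable_funeM; apply/measurable_EFinP; exact: mE.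
  - move=> t /=; rewrite in_itv/= andbT => t1.
    rewrite -EFinM lee_fin.
    rewrite (_ : 2 * C * _ = C * expR (2^-1 * t) * expR (- t)).
      by rewrite ler_wpM2r ?expR_ge0// hC// ltW.
    rewrite -[RHS]mulrA -expRD (_ : 2^-1 * t - t = - 2^-1 * t); first by field.
    by field.
rewrite ge0_integralZl//; last 2 first.
- by apply/measurable_EFinP; exact: mE.
- by rewrite lee_fin mulr_ge0.
apply: (@le_lt_trans _ _ ((2 * C)%:E * 1%:E)%E); last by rewrite -EFinM ltry.
apply: lee_wpmul2l; first by rewrite lee_fin mulr_ge0.
rewrite -(@integral_expRN 2^-1)//; apply: ge0_subset_integral => //.
- by apply/measurable_EFinP; exact: mE.
- by move=> t /=; rewrite !in_itv/= !andbT; apply: lt_trans.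
Qed.

Lemma integral_Gamma (x : R) : 0 < x ->
  (\int[mu]_(t in `]0%R, +oo[) (t `^ (x - 1) * expR (- t))%:E = (Gamma x)%:E)%E.
Proof. by move=> x0; rewrite (integrable_EFin_Rintegral _ (integrable_Gamma x0)). Qed.

(** On []0, 1]] the exponential is at least [expR (- 1)], whence the lower bound
    [expR (- 1) / x]. *)
Lemma Gamma_gt0 (x : R) : 0 < x -> 0 < Gamma x.
Proof.
move=> x0; rewrite -lte_fin -integral_Gamma//.
apply: (@lt_le_trans _ _ (expR (- 1) * x^-1)%:E).
  by rewrite lte_fin mulr_gt0 ?expR_gt0 ?invr_gt0.
rewrite EFinM -integral_powR_itv01// -ge0_integralZl//=; last 2 first.
- by apply/measurable_EFinP/measurable_funTS; exact: measurable_powR.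
- by move=> t _; rewrite lee_fin powR_ge0.
have mG (D : set R) : measurable D -> D `<=` `]0, +oo[ ->
    measurable_fun D (fun t => (t `^ (x - 1) * expR (- t))%:E).
  move=> mD D0; apply/measurable_EFinP.
  apply: measurable_fun_gt0 => // t t0.
  exact: continuous_at_Gamma_integrand1.
have s01 : (`]0, 1] : set R) `<=` `]0, +oo[.
  by move=> t/=; rewrite !in_itv/= => /andP[->].
apply: (@le_trans _ _ (\int[mu]_(t in `]0%R, 1%R]) (t `^ (x - 1) * expR (- t))%:E)%E).
  apply: ge0_le_integral => //.
  - by move=> t _; rewrite -EFinM lee_fin mulr_ge0 ?powR_ge0 ?expR_ge0.
  - apply: measurable_funeM; apply/measurable_EFinP/measurable_funTS.
    exact: measurable_powR.
  - exact: mG.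
  - move=> t /=; rewrite in_itv/= => /andP[t0 t1].
    by rewrite -EFinM lee_fin mulrC ler_wpM2l ?powR_ge0// ler_expR lerN2.
apply: ge0_subset_integral => //; first exact: mG.
by move=> t _; rewrite lee_fin mulr_ge0 ?powR_ge0 ?expR_ge0.
Qed.

Lemma integral_Gamma_scale (x c : R) : 0 < x -> 0 < c ->
  (\int[mu]_(t in `]0%R, +oo[) (t `^ (x - 1) * expR (- c * t))%:E =
   (c `^ (- x) * Gamma x)%:E)%E.
Proof.
move=> x0 c0.
have cG (t : R) : 0 < t -> continuous_at t (fun t => t `^ (x - 1) * expR (- t)).
  exact: continuous_at_Gamma_integrand1.
have mI : measurable_fun Rpos (fun t : R => (t `^ (x - 1) * expR (- c * t))%:E).
  apply/measurable_EFinP; apply: measurable_fun_gt0 => // t t0.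
  exact: continuous_at_Gamma_integrand.
have I0 t : (0 <= (t `^ (x - 1) * expR (- c * t))%:E)%E.
  by rewrite lee_fin mulr_ge0 ?powR_ge0 ?expR_ge0.
have cx0 : 0 < c `^ x by rewrite powR_gt0.
rewrite EFinM -integral_Gamma//.
rewrite (ge0_integral_scale cG _ c0); last first.
  by move=> t t0; rewrite mulr_ge0 ?powR_ge0 ?expR_ge0.
have -> : (\int[mu]_(t in `]0%R, +oo[)
      ((c * t) `^ (x - 1) * expR (- (c * t)) * c)%:E =
    (c `^ x)%:E * \int[mu]_(t in `]0%R, +oo[) (t `^ (x - 1) * expR (- c * t))%:E)%E.
  rewrite -ge0_integralZl ?lee_fin ?powR_ge0//.
  apply: eq_integral => t /set_mem/=; rewrite in_itv/= andbT => t0.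
  rewrite -EFinM; congr EFin.
  rewrite powRM ?ltW// mulNr -(mulr_powRB1 (ltW c0) x0); ring.
by rewrite muleA -EFinM powRN mulVf ?mul1e// gt_eqF.
Qed.

Lemma Gamma1 : Gamma 1 = 1 :> R.
Proof.
apply: EFin_inj; rewrite -integral_Gamma//.
apply: etrans (integral_expRN ltr01); apply: eq_integral => t _; congr EFin.
by rewrite subrr powRr0 !mul1r mulN1r.
Qed.

End gamma_integrable.

(** * Derivatives and functional equations of gamma and digamma *)

Section gamma_derivative.
Context {R : realType}.
Local Notation mu := (@lebesgue_measure R).

Lemma is_derive1_unique (f : R -> R) (x a b : R) :
  is_derive x 1 f a -> is_derive x 1 f b -> a = b.
Proof. by move=> [_ <-] [_ <-]. Qed.

Lemma is_derive1M (f g : R -> R) (x a b : R) :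
  is_derive x 1 f a -> is_derive x 1 g b ->
  is_derive x 1 (fun y => f y * g y) (a * g x + f x * b).
Proof.
move=> df dg; have := is_deriveM df dg.
by rewrite /GRing.scale/= addrC [g x * a]mulrC.
Qed.

Lemma is_derive1V (f : R -> R) (x a : R) : f x != 0 ->
  is_derive x 1 f a -> is_derive x 1 (fun y => (f y)^-1) (- (f x) ^- 2 * a).
Proof. by move=> fx df; exact: is_deriveV. Qed.

(** Identities between gamma values hold only on an open half-line; as differentiation is local,
    that is enough to compare derivatives. *)
Lemma eq_gt_is_derive1 (f g : R -> R) (c x a : R) : c < x ->
  (forall y, c < y -> f y = g y) -> is_derive x 1 f a -> is_derive x 1 g a.
Proof.
move=> cx fg; apply: near_eq_is_derive.
by near=> y; apply: fg; near: y; exact: lt_nbhsr.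
Unshelve. end_near. Qed.

Lemma powRB1_expR (t x : R) : 0 < t -> t `^ (x - 1) = expR (x * ln t) * t^-1.
Proof.
by move=> t0; rewrite /powR gt_eqF// mulrBl mul1r expRD expRN lnK// posrE.
Qed.

Let h (t : R) := t^-1 * expR (- t).

(** The [k]-th derivative of gamma, written as an exponential moment in [ln t]; the [t^-1] in [h]
    comes from the exponent [x - 1]. *)
Let G_ (k : nat) (x : R) := \int[mu]_(t in Rpos) (expR (x * ln t) * (ln t ^+ k * h t)).

Let integrable_G k (x : R) : 0 < x ->
  mu.-integrable Rpos (EFin \o (fun t => expR (x * ln t) * (ln t ^+ k * h t))).
Proof.
elim: k x => [x x0|k ih x x0].
  apply: eq_integrable (integrable_Gamma x0) => // t /set_mem/=.
  rewrite in_itv/= andbT => t0; congr EFin.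
  by rewrite powRB1_expR// mul1r mulrA.
have mln : measurable_fun Rpos (@ln R) by apply: measurable_funTS; exact: measurable_ln.
(* The moment lemmas want an open window around [x]; its upper end is arbitrary. *)
have x1 : 0 < x < x + 1 by lra.
have ih' (y : R) : 0 < y < x + 1 -> mu.-integrable Rpos
    (EFin \o (fun t => expR (y * ln t) * (ln t ^+ k * h t))).
  by move=> /andP[y0 _]; exact: ih.
apply: eq_integrable (integrable_expRM_mul (mu := mu) (measurable_itv _) mln ih' x1) => //.
by move=> t _; congr EFin; rewrite exprS -mulrA.
Qed.

Let is_derive_G k (x : R) : 0 < x -> is_derive x (1:R) (G_ k) (G_ k.+1 x).
Proof.
move=> x0; have x1 : 0 < x < x + 1 by lra.
have ih' (y : R) : 0 < y < x + 1 -> mu.-integrable Rpos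
    (EFin \o (fun t => expR (y * ln t) * (ln t ^+ k * h t))).
  by move=> /andP[y0 _]; exact: integrable_G.
have := is_derive_integral_expRM (mu := mu) (measurable_itv _) ih' x1.
rewrite (_ : \int[mu]_(t in _) _ = G_ k.+1 x)//.
by apply: eq_Rintegral => t _; rewrite exprS -mulrA.
Qed.

Let GammaE : @Gamma R = G_ 0.
Proof.
apply/funext => x; apply: eq_Rintegral => t /set_mem/=.
rewrite in_itv/= andbT => t0.
by rewrite powRB1_expR// mul1r mulrA.
Qed.

Lemma is_derive_Gamma (x : R) : 0 < x ->
  is_derive x (1:R) (@Gamma R) (digamma x * Gamma x).
Proof.
move=> x0; rewrite /digamma divfK; last exact/lt0r_neq0/Gamma_gt0.
rewrite GammaE; have dG := is_derive_G 0 x0; rewrite derive1E derive_val.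
exact: dG.
Qed.

(** On the positive half-line digamma is the quotient of [G_ 1] by [G_ 0], both differentiable. *)
Lemma derivable_digamma (x : R) : 0 < x -> derivable (@digamma R) x 1.
Proof.
move=> x0; have dG := is_derive_G 0 x0; have dG1 := is_derive_G 1 x0.
have G0 : G_ 0 x != 0 by rewrite -GammaE; exact/lt0r_neq0/Gamma_gt0.
have dq := is_derive1M dG1 (is_derive1V G0 dG).
apply: ex_derive; apply: (eq_gt_is_derive1 x0 _ dq) => y y0.
by rewrite /digamma GammaE derive1E; have dGy := is_derive_G 0 y0; rewrite derive_val.
Qed.

(** Differentiation replaces integration by parts: the Laplace integral of [t]^ (x -
    1)[at]y[equals]y [^ (- x) * Gamma x], and its derivative at [y = 1] is [- Gamma (x + 1)] under
    the integral and [- x * Gamma x] in closed form. *)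
Lemma GammaS (x : R) : 0 < x -> Gamma (x + 1) = x * Gamma x.
Proof.
move=> x0.
have S y : 0 < y -> (\int[mu]_(t in Rpos) (expR (y * - t) * t `^ (x - 1))%:E =
    (y `^ (- x) * Gamma x)%:E)%E.
  move=> y0; rewrite -integral_Gamma_scale//; apply: eq_integral => t _.
  by rewrite mulrC mulrN mulNr.
have hint (y : R) : 0 < y < 2 -> mu.-integrable Rpos
    (EFin \o (fun t => expR (y * - t) * t `^ (x - 1))).
  move=> /andP[y0 _]; apply: ge0_integrable_fin (S _ y0) => //.
    apply: measurable_fun_gt0 => // t t0.
    under eq_fun do rewrite mulrC mulrN -mulNr.
    exact: continuous_at_Gamma_integrand.
  by move=> t _; rewrite mulr_ge0 ?expR_ge0 ?powR_ge0.
have h1 : ((0 : R) < 1) && ((1 : R) < 2) by lra.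
have := is_derive_integral_expRM (mu := mu) (measurable_itv _) hint h1.
have -> : \int[mu]_(t in Rpos) (expR (1 * - t) * (- t * t `^ (x - 1))) = - Gamma (x + 1).
  have -> : - Gamma (x + 1) =
      \int[mu]_(t in Rpos) (-1 * (t `^ (x + 1 - 1) * expR (- t))).
    by rewrite RintegralZl ?mulN1r//; apply: integrable_Gamma; rewrite addr_gt0.
  apply: eq_Rintegral => t /set_mem/=; rewrite in_itv/= andbT => t0.
  by rewrite addrK mul1r -(mulr_powRB1 (ltW t0) x0) mulN1r mulNr mulrN mulrC.
move=> d1.
have d2 : is_derive (1:R) (1:R) (fun y => y `^ (- x) * Gamma x) (- Gamma (x + 1)).
  apply: (eq_gt_is_derive1 ltr01 _ d1) => y y0.
  by rewrite /Rintegral S.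
have d3 : is_derive (1:R) (1:R) (fun y => y `^ (- x) * Gamma x) (- x * Gamma x).
  have dp := @is_derive1_powR R (- x) 1 ltr01.
  have dc : is_derive (1:R) (1:R) (fun=> Gamma x) 0 by exact: is_derive_cst.
  by have := is_derive1M dp dc; rewrite powR1 mulr0 addr0 mulr1.
by rewrite -[LHS]opprK (is_derive1_unique d2 d3) mulNr opprK.
Qed.

(** Differentiate [GammaS] and divide by [x * Gamma x]. *)
Lemma digammaS (x : R) : 0 < x -> digamma (x + 1) = digamma x + x^-1.
Proof.
move=> x0; have x10 : 0 < x + 1 by rewrite addr_gt0.
have d1 : is_derive x (1:R) (fun y => Gamma (y + 1)) (digamma (x + 1) * Gamma (x + 1)).
  have dG := is_derive_Gamma x10.
  have dx : is_derive x (1:R) (fun y : R => y + 1) 1.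
    by apply: is_derive_eq; rewrite addr0.
  have := @is_derive1_comp _ (@Gamma R) (fun y => y + 1) x _ _ dG dx.
  by rewrite mulr1.
have d2 : is_derive x (1:R) (fun y => y * Gamma y) (x * (digamma x * Gamma x) + Gamma x).
  have dG := is_derive_Gamma x0.
  have di : is_derive x (1:R) (fun y : R => y) 1 by exact: is_derive_id.
  by have := is_derive1M di dG; rewrite mul1r addrC.
have d3 : is_derive x (1:R) (fun y => y * Gamma y) (digamma (x + 1) * Gamma (x + 1)).
  by apply: (eq_gt_is_derive1 x0 _ d1) => y; exact: GammaS.
have := is_derive1_unique d2 d3; rewrite GammaS//.
have G0 : Gamma x != 0 by exact/lt0r_neq0/Gamma_gt0.
move=> e; apply: (mulIf (mulf_neq0 (lt0r_neq0 x0) G0)); rewrite -e.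
by field; exact: lt0r_neq0.
Qed.

Lemma Gamma_natS (n : nat) : Gamma (n.+1%:R) = n`!%:R :> R.
Proof.
elim: n => [|n ih]; first exact: Gamma1.
by rewrite -[n.+2]addn1 natrD GammaS ?ltr0n// ih factS natrM.
Qed.

End gamma_derivative.

(** * The beta integral *)

Section fubini_tonelli_in.
Context d1 d2 (T1 : measurableType d1) (T2 : measurableType d2) (R : realType).
Variables (m1 : {sigma_finite_measure set T1 -> \bar R})
  (m2 : {sigma_finite_measure set T2 -> \bar R}).

(** Tonelli on the whole product, applied to the extension of [F] by zero outside [A]*[B]. *)
Lemma fubini_tonelli_in (A : set T1) (B : set T2) (F : T1 * T2 -> \bar R) :
  measurable A -> measurable B -> measurable_fun setT F ->
  (forall z, 0 <= F z)%E ->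
  (\int[m1]_(x in A) \int[m2]_(y in B) F (x, y) =
   \int[m2]_(y in B) \int[m1]_(x in A) F (x, y))%E.
Proof.
move=> mA mB mF F0; pose f := F \_ (A `*` B).
have mf : measurable_fun setT f.
  apply/(measurable_restrictT _ _).1; first exact: measurableX.
  exact: measurable_funS mF.
have f0 z : (0 <= f z)%E by apply: erestrict_ge0 => // ? _; exact: F0.
rewrite integral_mkcond [RHS]integral_mkcond.
transitivity (\int[m1]_x \int[m2]_y f (x, y))%E.
  apply: eq_integral => x _; rewrite patchE; case: ifPn => [/set_mem Ax|/negP Ax].
    rewrite integral_mkcond; apply: eq_integral => y _; rewrite !patchE.
    by congr (if _ then _ else _); apply/idP/idP => /set_mem h; apply/mem_set => //; case: h.
  rewrite integral0_eq// => y _; rewrite /f patchE; case: ifPn => // /set_mem[/= Ax' _].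
  by exfalso; apply: Ax; exact/mem_set.
rewrite (fubini_tonelli f mf f0); apply: eq_integral => y _; rewrite patchE.
case: ifPn => [/set_mem By|/negP By].
  rewrite [RHS]integral_mkcond; apply: eq_integral => x _; rewrite !patchE.
  by congr (if _ then _ else _); apply/idP/idP => /set_mem h; apply/mem_set => //; case: h.
rewrite integral0_eq// => x _; rewrite /f patchE; case: ifPn => // /set_mem[/= _ By'].
by exfalso; apply: By; exact/mem_set.
Qed.

End fubini_tonelli_in.

Section beta.
Context {R : realType}.
Local Notation mu := (@lebesgue_measure R).

Lemma continuous_at1D (g : R -> R) (u : R) : continuous_at (1 + u) g ->
  continuous_at u (fun t => g (1 + t)).
Proof.
move=> cg; apply: (@continuous_comp _ _ _ (fun t : R => 1 + t) g) => //.
by apply: cvgD; [exact: cvg_cst|exact: cvg_id].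
Qed.

Lemma continuous_atM (f g : R -> R) (u : R) : continuous_at u f ->
  continuous_at u g -> continuous_at u (fun t => f t * g t).
Proof. by move=> cf cg; exact: cvgM. Qed.

Lemma continuous_at_beta_integrand (b w u : R) : 0 < u ->
  continuous_at u (fun u => u `^ (b - 1) * (1 + u) `^ (- w)).
Proof.
move=> u0; apply: continuous_atM; first exact: continuous_at_powR.
apply: (@continuous_at1D (@powR R ^~ (- w))).
by apply: continuous_at_powR; rewrite addr_gt0.
Qed.

(** Tonelli for the kernel [F]. Integrating first in [x] is Euler's integral at scale [1 + u] and
    produces [Gamma w] times the beta integrand; integrating first in [u] is Euler's integral at
    scale [x] and leaves [Gamma b] times the integrand of [Gamma (w - b)]. *)
Lemma beta_integral (b w : R) : 0 < b -> b < w ->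
  (\int[mu]_(u in `]0%R, +oo[) (u `^ (b - 1) * (1 + u) `^ (- w))%:E =
   (Gamma b * Gamma (w - b) / Gamma w)%:E)%E.
Proof.
move=> b0 bw; have w0 : 0 < w by exact: lt_trans bw.
have Gw : Gamma w != 0 by exact/lt0r_neq0/Gamma_gt0.
pose F (z : R * R) : \bar R :=
  (z.1 `^ (b - 1) * z.2 `^ (w - 1) * expR (- z.2) * expR (- (z.2 * z.1)))%:E.
have F0 z : (0 <= F z)%E by rewrite lee_fin !mulr_ge0 ?powR_ge0 ?expR_ge0.
have mF : measurable_fun [set: R * R] F.
  apply/measurable_EFinP; repeat apply: measurable_funM.
  - by apply: (@measurableT_comp _ _ _ _ _ _ (@powR R ^~ (b - 1))) => //; exact: measurable_powR.
  - by apply: (@measurableT_comp _ _ _ _ _ _ (@powR R ^~ (w - 1))) => //; exact: measurable_powR.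
  - by apply: measurableT_comp => //; exact: measurableT_comp.
  - apply: measurableT_comp => //; apply: measurableT_comp => //.
    exact: measurable_funM.
have := @fubini_tonelli_in _ _ _ _ _ mu mu Rpos Rpos F (measurable_itv _) (measurable_itv _) mF F0.
have -> : (\int[mu]_(u in Rpos) \int[mu]_(x in Rpos) F (u, x) =
  (Gamma w)%:E * \int[mu]_(u in `]0%R, +oo[) (u `^ (b - 1) * (1 + u) `^ (- w))%:E)%E.
  rewrite -ge0_integralZl//; last 3 first.
  - apply/measurable_EFinP; apply: measurable_fun_gt0 => // u u0.
    exact: continuous_at_beta_integrand.
  - by move=> u _; rewrite lee_fin mulr_ge0 ?powR_ge0.
  - by rewrite lee_fin ltW// Gamma_gt0.
  apply: eq_integral => u /set_mem/=; rewrite in_itv/= andbT => u0.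
  have u10 : 0 < 1 + u by rewrite addr_gt0.
  rewrite -EFinM mulrCA EFinM [X in (_ * X%:E)%E]mulrC -integral_Gamma_scale//.
  rewrite -ge0_integralZl//; last 3 first.
  - apply/measurable_EFinP; apply: measurable_fun_gt0 => // t t0.
    exact: continuous_at_Gamma_integrand.
  - by move=> t _; rewrite lee_fin mulr_ge0 ?powR_ge0 ?expR_ge0.
  - by rewrite lee_fin powR_ge0.
  apply: eq_integral => t _; rewrite -EFinM /F/=; congr EFin.
  by rewrite -!mulrA -expRD; congr (_ * (_ * expR _)); ring.
have -> : (\int[mu]_(x in Rpos) \int[mu]_(u in Rpos) F (u, x) =
  (Gamma b * Gamma (w - b))%:E)%E.
  have wb0 : 0 < w - b by rewrite subr_gt0.
  rewrite EFinM -(integral_Gamma wb0) -ge0_integralZl//; last 3 first.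
  - apply/measurable_EFinP; apply: measurable_fun_gt0 => // t t0.
    exact: continuous_at_Gamma_integrand1.
  - by move=> t _; rewrite lee_fin mulr_ge0 ?powR_ge0 ?expR_ge0.
  - by rewrite lee_fin ltW// Gamma_gt0.
  apply: eq_integral => x /set_mem/=; rewrite in_itv/= andbT => x0.
  have e : (x `^ (w - b - 1) = x `^ (w - 1) * x `^ (- b))%R.
    by rewrite -powRD; [congr powR; ring|rewrite lt0r_neq0 ?implybT].
  rewrite -EFinM (_ : Gamma b * _ = (x `^ (w - 1) * expR (- x)) * (x `^ (- b) * Gamma b)); last first.
    by rewrite e; ring.
  rewrite [RHS]EFinM -(integral_Gamma_scale b0 x0).
  rewrite -ge0_integralZl//; last 3 first.
  - apply/measurable_EFinP; apply: measurable_fun_gt0 => // t t0.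
    exact: continuous_at_Gamma_integrand.
  - by move=> t _; rewrite lee_fin mulr_ge0 ?powR_ge0 ?expR_ge0.
  - by rewrite lee_fin mulr_ge0 ?powR_ge0 ?expR_ge0.
  apply: eq_integral => t _; rewrite -EFinM /F/=; congr EFin.
  by rewrite mulNr; ring.
move=> e; rewrite (_ : Gamma b * _ / _ = (Gamma w)^-1 * (Gamma b * Gamma (w - b))).
  by rewrite [RHS]EFinM -e muleA -EFinM mulVf// mul1e.
by rewrite mulrC.
Qed.

Lemma beta_log_integral (b w : R) : 0 < b -> b < w ->
  (\int[mu]_(u in `]0%R, +oo[)
     (u `^ (b - 1) * ln (1 + u) * (1 + u) `^ (- w))%:E =
   (Gamma b * Gamma (w - b) / Gamma w * (digamma w - digamma (w - b)))%:E)%E.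
Proof.
move=> b0 bw; have w0 : 0 < w by exact: lt_trans bw.
have wb0 : 0 < w - b by rewrite subr_gt0.
have bE (y u : R) : 0 < u ->
    expR (y * - ln (1 + u)) * u `^ (b - 1) = u `^ (b - 1) * (1 + u) `^ (- y).
  by move=> u0; rewrite /powR gt_eqF// gt_eqF ?addr_gt0// mulrN mulNr mulrC.
have S (y : R) : b < y ->
    (\int[mu]_(u in Rpos) (expR (y * - ln (1 + u)) * u `^ (b - 1))%:E =
    (Gamma b * Gamma (y - b) / Gamma y)%:E)%E.
  move=> bY; rewrite -(beta_integral b0 bY); apply: eq_integral => u /set_mem/=.
  by rewrite in_itv/= andbT => u0; rewrite bE.
have hint (y : R) : b < y < w + 1 -> mu.-integrable Rpos
    (EFin \o (fun u => expR (y * - ln (1 + u)) * u `^ (b - 1))).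
  move=> /andP[bY _]; apply: ge0_integrable_fin (S _ bY) => //.
    apply: (@eq_measurable_fun _ _ _ _ _ (fun u => u `^ (b - 1) * (1 + u) `^ (- y))).
      by move=> u /set_mem/=; rewrite in_itv/= andbT => u0; rewrite bE.
    apply: measurable_fun_gt0 => // u u0; exact: continuous_at_beta_integrand.
  by move=> u _; rewrite mulr_ge0 ?expR_ge0 ?powR_ge0.
have bw1 : (b < w) && (w < w + 1) by lra.
have d1 := is_derive_integral_expRM (mu := mu) (measurable_itv _) hint bw1.
have mln : measurable_fun Rpos (fun u : R => - ln (1 + u)).
  apply: measurable_fun_gt0 => // u u0; apply: cvgN.
  by apply: (@continuous_at1D (@ln R)); apply: continuous_ln; rewrite addr_gt0.
have I1 := integrable_expRM_mul (mu := mu) (measurable_itv _) mln hint bw1.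
set J := (X in is_derive _ _ _ X) in d1.
have d2 : is_derive w (1:R) (fun y => Gamma b * Gamma (y - b) / Gamma y) J.
  by apply: (eq_gt_is_derive1 bw _ d1) => y bY; rewrite /Rintegral S.
have Gw : Gamma w != 0 by exact/lt0r_neq0/Gamma_gt0.
have d3 : is_derive w (1:R) (fun y => Gamma b * Gamma (y - b) / Gamma y)
    (- (Gamma b * Gamma (w - b) / Gamma w * (digamma w - digamma (w - b)))).
  (* The quotient rule with [B], [g], [G] standing for gamma at [b], [w - b], [w], and [r], [p] for
     digamma at [w - b], [w]. *)
  have alg (B G g p r : R) : G != 0 ->
      (0 * g + B * (r * g * 1)) / G + B * g * (- G ^- 2 * (p * G)) =
      - (B * g / G * (p - r)) by move=> G0; field.
  have dG := is_derive_Gamma w0; have dGb := is_derive_Gamma wb0.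
  have dx : is_derive w (1:R) (fun y : R => y - b) 1.
    have := is_deriveB (is_derive_id w (1:R)) (is_derive_cst b w (1:R)).
    by rewrite subr0.
  have dc : is_derive w (1:R) (fun=> Gamma b) 0 by exact: is_derive_cst.
  have d4 := @is_derive1_comp _ (@Gamma R) (fun y => y - b) w _ _ dGb dx.
  have := is_derive1M (is_derive1M dc d4) (is_derive1V Gw dG).
  by rewrite alg.
have JE : - J = Gamma b * Gamma (w - b) / Gamma w * (digamma w - digamma (w - b)).
  by rewrite (is_derive1_unique d2 d3) opprK.
rewrite -JE /J EFinN -(integrable_EFin_Rintegral (mu := mu) (measurable_itv _) I1).
rewrite -integralN; last first.
  exact: integrable_add_def.
apply: eq_integral => u /set_mem/=; rewrite in_itv/= andbT => u0.
congr EFin; rewrite mulNr mulrN opprK [RHS]mulrCA (bE w u u0); ring.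
Qed.

(** With [b = y - x] and [w = y], the nonnegative integral of [beta_log_integral] is a positive
    quotient of gammas times [digamma y - digamma x]. *)
Lemma le_digamma (x y : R) : 0 < x -> x <= y -> digamma x <= digamma y.
Proof.
move=> x0; rewrite le_eqVlt => /predU1P[->//|xy].
have y0 : 0 < y by exact: lt_trans xy.
have := @beta_log_integral (y - x) y.
rewrite subr_gt0 xy ltrBlDr ltrDl x0 => /(_ isT isT) e.
rewrite opprB addrCA subrr addr0 in e.
rewrite -subr_ge0 -(pmulr_rge0 _ (_ : 0 < Gamma (y - x) * Gamma x / Gamma y)); last first.
  by rewrite divr_gt0 ?mulr_gt0 ?Gamma_gt0// subr_gt0.
rewrite -lee_fin -e; apply: integral_ge0 => u /=; rewrite in_itv/= andbT => u0.
by rewrite lee_fin !mulr_ge0 ?powR_ge0// ln_ge0// lerDl ltW.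
Qed.

End beta.

(** * The trigamma function *)

Section trigamma.
Context {R : realType}.
Local Notation mu := (@lebesgue_measure R).

(** The absolute value of [E] is periodic with period [c], hence its value at [a] is bounded by
    [1 / (a + c * n)] for every [n]. *)
Lemma antiperiodic_eq0 (E : R -> R) (c : R) : 0 < c ->
  (forall a, 0 < a -> `|E a| <= a^-1) ->
  (forall a, 0 < a -> E (a + c) = - E a) -> forall a, 0 < a -> E a = 0.
Proof.
move=> c0 leE Ec a a0; apply/eqP; rewrite -normr_le0 leNgt; apply/negP => Ea0.
have Ean n : `|E (a + c *+ n)| = `|E a|.
  elim: n => [|n ih]; first by rewrite mulr0n addr0.
  by rewrite mulrSr addrA Ec ?normrN// ltr_wpDr// mulrn_wge0// ltW.
pose N := Num.Def.archi_bound (`|E a|^-1 / c).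
have hN : `|E a|^-1 < c *+ N.
  rewrite -mulr_natr mulrC -ltr_pdivrMr//.
  by apply: archi_boundP; rewrite divr_ge0 ?invr_ge0// ltW.
have aN0 : 0 < a + c *+ N by rewrite ltr_wpDr// mulrn_wge0// ltW.
have := leE _ aN0; rewrite Ean => h.
have : a + c *+ N <= `|E a|^-1 by rewrite -[leLHS]invrK lef_pV2 ?posrE ?invr_gt0.
by rewrite leNgt (lt_trans hN)// ltrDr.
Qed.

Let h (t : R) := (1 + t ^+ 3)^-1.

Let h_ge0 t : 0 <= t -> 0 <= h t.
Proof. by move=> t0; rewrite invr_ge0 addr_ge0// exprn_ge0. Qed.

Lemma continuous_at_inv1Dcube (t : R) : 0 < t -> continuous_at t (fun t => (1 + t ^+ 3)^-1).
Proof.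
move=> t0; apply: cvgV; first by rewrite lt0r_neq0// addr_gt0// exprn_gt0.
by apply: cvgD; [exact: cvg_cst|exact: exprn_continuous].
Qed.

Let measurable_powR_h (a : R) : measurable_fun Runit (fun t : R => t `^ (a - 1) * h t).
Proof.
apply: measurable_fun_gt0 => //.
  by move=> t /=; rewrite !in_itv/= => /andP[->].
by move=> t t0; apply: continuous_atM; [exact: continuous_at_powR|exact: continuous_at_inv1Dcube].
Qed.

Let integrable_powR_h (a : R) : 0 < a ->
  mu.-integrable Runit (EFin \o (fun t => t `^ (a - 1) * h t)).
Proof.
move=> a0.
have ip : mu.-integrable Runit (EFin \o (fun t => t `^ (a - 1))).
  apply: ge0_integrable_fin (integral_powR_itv01 a0) => //.
  - by apply: measurable_funTS; exact: measurable_powR.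
  - by move=> t _; exact: powR_ge0.
apply: le_integrable ip => //.
  by apply/measurable_EFinP; exact: measurable_powR_h.
move=> t /=; rewrite in_itv/= => /andP[t0 t1].
have t3 : 0 < t ^+ 3 by rewrite exprn_gt0.
rewrite lee_fin !ger0_norm ?mulr_ge0 ?powR_ge0 ?(h_ge0 (ltW t0))//.
by rewrite ler_piMr ?powR_ge0// invf_le1 ?addr_gt0// lerDl ltW.
Qed.

Let F (a : R) := \int[mu]_(t in Runit) (t `^ (a - 1) * h t).

Let F_ge0 a : 0 <= F a.
Proof.
apply: Rintegral_ge0 => t /=; rewrite in_itv/= => /andP[t0 _].
by rewrite mulr_ge0 ?powR_ge0 ?h_ge0// ltW.
Qed.

Let FD3 a : 0 < a -> F a + F (a + 3) = a^-1.
Proof.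
move=> a0; have a30 : 0 < a + 3 by rewrite addr_gt0.
rewrite /F -RintegralD//; [|exact: integrable_powR_h..].
rewrite (_ : a^-1 = \int[mu]_(t in Runit) (t `^ (a - 1))); last first.
  by rewrite /Rintegral integral_powR_itv01.
apply: eq_Rintegral => t /set_mem/=; rewrite in_itv/= => /andP[t0 _].
have -> : (t `^ (a + 3 - 1) = t `^ (a - 1) * t ^+ 3)%R.
  rewrite -powR_mulrn ?ltW// -powRD; last by rewrite lt0r_neq0 ?implybT.
  by congr powR; ring.
rewrite -mulrDl -[X in X + _]mulr1 -mulrDr mulfK//.
by rewrite lt0r_neq0// addr_gt0// exprn_gt0.
Qed.

Let D (a : R) := (digamma ((a + 3) / 6) - digamma (a / 6)) / 6.

Let D_ge0 a : 0 < a -> 0 <= D a.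
Proof.
move=> a0; rewrite divr_ge0// subr_ge0 le_digamma//; first by rewrite divr_gt0.
by rewrite ler_pM2r// lerDl.
Qed.

(** The middle terms cancel, leaving a unit step of digamma at [a / 6], which is worth [6 / a]. *)
Let DD3 a : 0 < a -> D a + D (a + 3) = a^-1.
Proof.
move=> a0; rewrite /D (_ : (a + 3 + 3) / 6 = a / 6 + 1); last by field.
rewrite digammaS ?divr_gt0//.
move: (digamma _) (digamma _) => x y.
by field; rewrite lt0r_neq0.
Qed.

Let FE a : 0 < a -> F a = D a.
Proof.
move=> a0; apply/eqP; rewrite -subr_eq0; apply/eqP.
apply: (@antiperiodic_eq0 (fun x => F x - D x) 3) => // {a0}a a0.
  have a30 : 0 < a + 3 by rewrite addr_gt0.
  have := FD3 a0; have := DD3 a0; have := F_ge0 a; have := F_ge0 (a + 3).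
  have := D_ge0 a0; have := D_ge0 a30.
  move: (F _) (F _) (D _) (D _) => x y z u ? ? ? ? ? ?.
  (* Nonnegativity and the sum [1 / a] place both [F a] and [D a] in [[0, 1 / a]]. *)
  by rewrite ler_norml; lra.
have := FD3 a0; have := DD3 a0.
move: (F _) (F _) (D _) (D _) => x y z u ? ?; lra.
Qed.

Let h' (t : R) := t^-1 * h t.

Let powR_hE (a t : R) : 0 < t -> expR (a * ln t) * h' t = t `^ (a - 1) * h t.
Proof. by move=> t0; rewrite powRB1_expR// mulrA. Qed.

Let integrable_h' (b : R) : forall a : R, 0 < a < b ->
  mu.-integrable Runit (EFin \o (fun t => expR (a * ln t) * h' t)).
Proof.
move=> a /andP[a0 _]; apply: eq_integrable (integrable_powR_h a0) => // t.
by move/set_mem; rewrite /= in_itv/= => /andP[t0 _]; rewrite powR_hE.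
Qed.

Lemma integrable_powR_ln (a : R) : 0 < a -> mu.-integrable Runit
  (EFin \o (fun t => t `^ (a - 1) * ln t / (1 + t ^+ 3))).
Proof.
move=> a0; have ab : 0 < a < a + 1 by rewrite a0 ltrDl ltr01.
have mln : measurable_fun Runit (@ln R) by apply: measurable_funTS; exact: measurable_ln.
have := integrable_expRM_mul (mu := mu) (measurable_itv _) mln (@integrable_h' _) ab.
apply: eq_integrable => // t /set_mem/=; rewrite in_itv/= => /andP[t0 _].
by rewrite mulrCA powR_hE// mulrCA mulrA.
Qed.

(** Differentiate [F = D] in [a]; one factor 6 of the 36 is in [D], the other comes from the inner
    derivative. *)
Lemma integral_powR_ln (a : R) : 0 < a ->
  \int[mu]_(t in Runit) (t `^ (a - 1) * ln t / (1 + t ^+ 3)) =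
  (trigamma ((a + 3) / 6) - trigamma (a / 6)) / 36.
Proof.
move=> a0; have ab : 0 < a < a + 1 by rewrite a0 ltrDl ltr01.
have := is_derive_integral_expRM (mu := mu) (measurable_itv _) (@integrable_h' _) ab.
set J := (X in is_derive _ _ _ X) => dF.
have -> : \int[mu]_(t in Runit) (t `^ (a - 1) * ln t / (1 + t ^+ 3)) = J.
  apply: eq_Rintegral => t /set_mem/=; rewrite in_itv/= => /andP[t0 _].
  by rewrite mulrCA powR_hE// mulrCA mulrA.
have dFD : is_derive a (1:R) D J.
  apply: (eq_gt_is_derive1 a0 _ dF) => b b0; rewrite -FE//.
  apply: eq_Rintegral => t /set_mem/=; rewrite in_itv/= => /andP[t0 _].
  by rewrite powR_hE.
have dpsi (c : R) : 0 <= c ->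
    is_derive a (1:R) (fun b => digamma ((b + c) / 6)) (trigamma ((a + c) / 6) / 6).
  move=> c0; have ac0 : 0 < (a + c) / 6 by rewrite divr_gt0// ltr_wpDr.
  have dp : is_derive ((a + c) / 6) (1:R) (@digamma R) (trigamma ((a + c) / 6)).
    by rewrite /trigamma derive1E; apply/derivableP; exact: derivable_digamma.
  have d1 : is_derive a (1:R) (fun b : R => (b + c) * 6^-1) 6^-1.
    have := is_derive1M (is_deriveD (is_derive_id a (1:R)) (is_derive_cst c a (1:R)))
      (is_derive_cst (6^-1 : R) a (1:R)).
    by rewrite mulr0 !addr0 mul1r.
  exact: (@is_derive1_comp _ (@digamma R) (fun b : R => (b + c) * 6^-1) a _ _ dp d1).
have d3 := dpsi 3 (ler0n _ _); have d0 := dpsi 0 (lexx _).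
have d6 := is_derive1M (is_deriveB d3 d0) (is_derive_cst (6^-1 : R) a (1:R)).
have dD : is_derive a (1:R) D (((trigamma ((a + 3) / 6) - trigamma (a / 6)) / 36)).
  move: d6; rewrite addr0 mulr0 addr0.
  rewrite (_ : (trigamma ((a + 3) / 6) / 6 - trigamma (a / 6) / 6) * 6^-1 = ((trigamma ((a + 3) / 6) - trigamma (a / 6)) / 36)).
    rewrite (_ : (fun y => _) = D)//.
    by apply/funext => b; rewrite /D !fctE/= addr0.
  move: (trigamma _) (trigamma _) => x y.
  by field.
exact: is_derive1_unique dFD dD.
Qed.

End trigamma.

(** * The logarithmic integral *)

Section series.
Context {R : realType}.

(** This is how convergence of the gamma-psi series is obtained: its terms are nonnegative and its
    extended sum is finite. *)
Lemma nneseries_fin_cvg (u : R^nat) (l : R) : (forall n, 0 <= u n) ->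
  (\sum_(n <oo) (u n)%:E = l%:E)%E -> series u @ \oo --> l.
Proof.
move=> u0 ul.
have : (\sum_(0 <= k < n) (u k)%:E)%E @[n --> \oo] --> l%:E.
  by rewrite -ul; apply: is_cvg_nneseries => n _ _; rewrite lee_fin.
under eq_fun do rewrite sumEFin.
by move/fine_cvg.
Qed.

Lemma nneseries_geometric (a z : R) : 0 <= z < 1 ->
  (\sum_(n <oo) (a * z ^+ n)%:E = (a / (1 - z))%:E)%E.
Proof.
move=> /andP[z0 z1]; apply/cvg_lim => //.
under eq_fun do rewrite sumEFin.
apply: cvg_EFin; first exact: nearW.
by apply: cvg_geometric_series; rewrite ger0_norm.
Qed.

End series.

(** * Series expansion on the half-line and folding onto the unit interval *)

Section log_integral.
Context {R : realType}.
Local Notation mu := (@lebesgue_measure R).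
Variable s : R.
Hypothesis s0 : 0 < s.
Hypothesis s2 : s < 2.

(** Taken at [a = s] and [a = 3 - s], it gives the two summands of the integrand in [t]. *)
Let phi (a t : R) : R := t `^ (a - 1) * ln (1 + t) / (1 + t ^+ 3).

Let cphi a (t : R) : 0 < t -> continuous_at t (phi a).
Proof.
move=> t0; apply: continuous_atM; last exact: continuous_at_inv1Dcube.
apply: continuous_atM; first exact: continuous_at_powR.
by apply: (@continuous_at1D _ (@ln R)); apply: continuous_ln; rewrite addr_gt0.
Qed.

Let phi_ge0 a (t : R) : 0 < t -> 0 <= phi a t.
Proof.
move=> t0; rewrite !mulr_ge0 ?powR_ge0//; first by rewrite ln_ge0// lerDl ltW.
by rewrite invr_ge0 addr_ge0// exprn_ge0// ltW.
Qed.

Let sub01 : Runit `<=` (Rpos : set R).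
Proof. by move=> t /=; rewrite !in_itv/= => /andP[->]. Qed.

Let mphi a (D : set R) : measurable D -> D `<=` Rpos ->
  measurable_fun D (fun t => (phi a t)%:E).
Proof.
by move=> mD D0; apply/measurable_EFinP; apply: measurable_fun_gt0 => // t; exact: cphi.
Qed.

(** The factors are grouped as in [beta_log_integral] with [b = n + s] and [w = 2n + 3]. *)
Let term (n : nat) : R :=
  3 ^+ n * (Gamma (n%:R + s) * Gamma (n%:R + 3 - s) / (2 * n + 2)`!%:R *
    (digamma (2 * n%:R + 3) - digamma (n%:R + 3 - s))).

Let summand (n : nat) (t : R) : R :=
  3 ^+ n * (t `^ (n%:R + s - 1) * ln (1 + t) * (1 + t) `^ (- (2 * n%:R + 3))).

Let summand_ge0 n t : 0 < t -> 0 <= summand n t.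
Proof.
move=> t0; rewrite !mulr_ge0 ?powR_ge0 ?exprn_ge0//.
by rewrite ln_ge0// lerDl ltW.
Qed.

Let csummand n (t : R) : 0 < t -> continuous_at t (summand n).
Proof.
move=> t0; apply: continuous_atM; first exact: cvg_cst.
have c1 (g : R -> R) : {for 1 + t, continuous g} -> continuous_at t (fun u => g (1 + u)).
  exact: continuous_at1D.
apply: continuous_atM; last by apply: (c1 (@powR R ^~ _)); apply: continuous_at_powR; rewrite addr_gt0.
apply: continuous_atM; first exact: continuous_at_powR.
by apply: c1; apply: continuous_ln; rewrite addr_gt0.
Qed.

Let integral_summand n :
  (\int[mu]_(t in Rpos) (summand n t)%:E = (term n)%:E)%E.
Proof.
have n0 : 0 <= n%:R :> R by [].
have b0 : 0 < n%:R + s by rewrite ltr_wpDl.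
have bw : n%:R + s < 2 * n%:R + 3.
  by move: n0 s2; move: (n%:R : R) => x x0 ?; lra.
have e := beta_log_integral b0 bw.
have -> : term n = 3 ^+ n * (Gamma (n%:R + s) * Gamma (2 * n%:R + 3 - (n%:R + s)) / Gamma (2 * n%:R + 3) *
    (digamma (2 * n%:R + 3) - digamma (2 * n%:R + 3 - (n%:R + s)))).
  rewrite /term (_ : 2 * n%:R + 3 - (n%:R + s) = n%:R + 3 - s); last by ring.
  rewrite (_ : Gamma (2 * n%:R + 3) = (2 * n + 2)`!%:R)//.
  by rewrite -Gamma_natS; congr Gamma; rewrite -addnS natrD natrM.
rewrite EFinM -e -ge0_integralZl//.
- apply/measurable_EFinP; apply: measurable_fun_gt0 => // t t0.
  apply: continuous_atM.
    apply: continuous_atM; first exact: continuous_at_powR.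
    by apply: (@continuous_at1D _ (@ln R)); apply: continuous_ln; rewrite addr_gt0.
  by apply: (@continuous_at1D _ (@powR R ^~ _)); apply: continuous_at_powR; rewrite addr_gt0.
- move=> t /=; rewrite in_itv/= andbT => t0.
  by rewrite lee_fin !mulr_ge0 ?powR_ge0// ln_ge0// lerDl ltW.
Qed.

Let term_ge0 n : 0 <= term n.
Proof.
rewrite -lee_fin -integral_summand; apply: integral_ge0 => t /=.
by rewrite in_itv/= andbT lee_fin; exact: summand_ge0.
Qed.

(* [1 + t ^+ 3 = (1 + t) ^+ 3 * (1 - 3 * t / (1 + t) ^+ 2)]. *)
Let sum_summand (t : R) : 0 < t ->
  (\sum_(n <oo) (summand n t)%:E = (phi s t)%:E)%E.
Proof.
move=> t0; pose z := 3 * t / (1 + t) ^+ 2.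
have t10 : 0 < 1 + t by rewrite addr_gt0.
have z0 : 0 <= z by rewrite divr_ge0 ?mulr_ge0 ?exprn_ge0// ltW.
(* This amounts to [0 < t ^+ 2 - t + 1]. *)
have z1 : z < 1.
  by rewrite ltr_pdivrMr ?exprn_gt0// mul1r; nra.
pose a := t `^ (s - 1) * ln (1 + t) / (1 + t) ^+ 3.
have sE n : summand n t = a * z ^+ n.
  rewrite /summand powRN -[2 * _ + 3]/(2 * n%:R + 3) -natrM -natrD powR_mulrn ?ltW//.
  rewrite (_ : t `^ (n%:R + s - 1) = t ^+ n * t `^ (s - 1)); last first.
    rewrite -powR_mulrn ?ltW// -powRD; last by rewrite lt0r_neq0 ?implybT.
    by rewrite addrA.
  rewrite /a /z expr_div_n exprMn exprD exprM.
  by field; rewrite !expf_neq0 ?lt0r_neq0.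
under eq_eseriesr do rewrite sE.
rewrite nneseries_geometric ?z0//; congr EFin.
rewrite /phi /a /z.
have h2 : 1 - 3 * t / (1 + t) ^+ 2 = (1 + t ^+ 3) / (1 + t) ^+ 3.
  by field; rewrite lt0r_neq0.
have t3 : 1 + t ^+ 3 != 0 by rewrite lt0r_neq0// addr_gt0// exprn_gt0.
by rewrite h2; field; rewrite t3 lt0r_neq0.
Qed.

(** Integration term by term is allowed because all the summands are nonnegative. *)
Let integral_phi_series :
  (\int[mu]_(t in Rpos) (phi s t)%:E = \sum_(n <oo) (term n)%:E)%E.
Proof.
under eq_eseriesr do rewrite -integral_summand.
rewrite -integral_nneseries//.
- by apply: eq_integral => t /set_mem/=; rewrite in_itv/= andbT => t0; rewrite sum_summand.
- move=> n; apply/measurable_EFinP; apply: measurable_fun_gt0 => // t; exact: csummand.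
- by move=> n t /=; rewrite in_itv/= andbT lee_fin; exact: summand_ge0.
Qed.

(* Inverting [t] on [[1, +oo[] turns [ln (1 + t)] into [ln (1 + t) - ln t]. *)
Let integral_phi_inv :
  (\int[mu]_(t in Rpos) (phi s t)%:E =
   \int[mu]_(t in Runit) (phi s t + phi (3 - s) t)%:E +
   \int[mu]_(t in Runit) (- (t `^ (3 - s - 1) * ln t / (1 + t ^+ 3)))%:E)%E.
Proof.
have -> : (Rpos : set R) = Runit `|` `]1, +oo[.
  by rewrite -itv_bndbnd_setU// bnd_simp.
have sub1y : (`]1, +oo[ : set R) `<=` Rpos.
  by move=> t /=; rewrite !in_itv/= !andbT; exact: lt_trans.
rewrite ge0_integral_setU//=; last 3 first.
- by apply: mphi; [exact: measurableU|move=> t []; [exact: sub01|exact: sub1y]].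
- by move=> t h; rewrite lee_fin phi_ge0//; case: h => [/sub01|/sub1y]/=; rewrite in_itv/= andbT.
- apply/disj_setPS => t /=; rewrite !in_itv/= => -[/andP[_ t1] /andP[]].
  by rewrite ltNge t1.
rewrite (@integral_itv_obnd_cbnd _ 1); last exact: mphi.
rewrite (ge0_integral_inv (@cphi s) (@phi_ge0 s)).
(* Since [ln t <= 0] on the unit interval, the correction term is nonnegative as well, and integrals
   add in the extended reals. *)
have ln_ge0' (t : R) : Runit t -> 0 <= - (t `^ (3 - s - 1) * ln t / (1 + t ^+ 3)).
  move=> /=; rewrite in_itv/= => /andP[t0 t1].
  rewrite oppr_ge0 pmulr_lle0 ?invr_gt0 ?addr_gt0 ?exprn_gt0//.
  by rewrite mulr_ge0_le0 ?powR_ge0 ?ln_le0.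
have phi_ge0' a (t : R) : Runit t -> (0 <= (phi a t)%:E)%E.
  by move=> /=; rewrite in_itv/= => /andP[t0 t1]; rewrite lee_fin phi_ge0.
have ml : measurable_fun Runit (fun t : R => (- (t `^ (3 - s - 1) * ln t / (1 + t ^+ 3)))%:E).
  have s3 : 0 < 3 - s by rewrite subr_gt0 (lt_trans s2)// ltr_nat.
  have /measurable_EFinP mi := measurable_int mu (integrable_powR_ln s3).
  by apply/measurable_EFinP; exact: measurableT_comp mi.
under [in RHS]eq_integral do rewrite EFinD.
rewrite ge0_integralD//; [|exact: phi_ge0'|exact: mphi|exact: phi_ge0'|exact: mphi].
rewrite -[RHS]addeA; congr (_ + _)%E.
rewrite -ge0_integralD//; [|exact: phi_ge0'|exact: mphi].
apply: eq_integral => t /set_mem/=; rewrite in_itv/= => /andP[t0 t1].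
rewrite -EFinD; congr EFin; rewrite /phi.
have t10 : 0 < 1 + t by rewrite addr_gt0.
rewrite (_ : 1 + t^-1 = (1 + t) / t); last by field; rewrite lt0r_neq0.
rewrite ln_div ?posrE//.
(* With the Jacobian [t ^- 2] and the factor [t ^+ 3] from [1 + t ^- 3], the exponent becomes
   [1 - s - 2 + 3 = 2 - s]. *)
have -> : t^-1 `^ (s - 1) = t `^ (3 - s - 1) / t.
  rewrite -powR_inv1 ?ltW// -powRrM mulN1r.
  rewrite -powRD; last by rewrite lt0r_neq0 ?implybT.
  by congr powR; ring.
have t3 : 1 + t ^+ 3 != 0 by rewrite lt0r_neq0// addr_gt0// exprn_gt0.
field.
by rewrite t3 lt0r_neq0.
Qed.

(** Integrability of [f] and of the logarithmic term makes the extended identity [integral_phi_inv]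
    finite; [integral_powR_ln] at [a = 3 - s] supplies the trigamma values. *)
Lemma cvg_log_integral_series (f := fun t : R =>
    (t `^ (2 - s) + t `^ (s - 1)) * ln (1 + t) / (1 + t ^+ 3)) :
  mu.-integrable Runit (EFin \o f) ->
  series (fun n => 3 ^+ n * Gamma (n%:R + 3 - s) * Gamma (n%:R + s)
    / (2 * n + 2)`!%:R * (digamma (2 * n%:R + 3) - digamma (n%:R + 3 - s)))
    @ \oo -->
  \int[mu]_(t in Runit) f t
    - (trigamma ((6 - s) / 6) - trigamma ((3 - s) / 6)) / 36.
Proof.
move=> fi; have s3 : 0 < 3 - s by rewrite subr_gt0 (lt_trans s2)// ltr_nat.
rewrite [X in series X](_ : _ = term); last first.
  by apply/funext => n; rewrite /term; ring.
apply: nneseries_fin_cvg term_ge0 _.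
rewrite -integral_phi_series integral_phi_inv.
have -> : (\int[mu]_(t in Runit) (phi s t + phi (3 - s) t)%:E =
    \int[mu]_(t in Runit) (f t)%:E)%E.
  apply: eq_integral => t _; congr EFin; rewrite /f /phi.
  by rewrite (_ : 3 - s - 1 = 2 - s); [ring|ring].
rewrite (integrable_EFin_Rintegral (mu := mu) (measurable_itv _) fi).
have li := integrable_powR_ln s3.
under [X in (_ + X)%E]eq_integral do rewrite EFinN.
rewrite integralN; last exact: integrable_add_def li.
rewrite (integrable_EFin_Rintegral (mu := mu) (measurable_itv _) li).
rewrite (integral_powR_ln s3) (_ : 6 - s = 3 - s + 3) ?EFinB//; ring.
Qed.

End log_integral.

(** * The integrand in the original variable *)

Section log_integrand.
Context {R : realType}.
Local Notation mu := (@lebesgue_measure R).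
Variable q : R.
Hypothesis q_gt : 1 / 2 < q.

Let q0 : 0 < q. Proof. by apply: lt_trans q_gt; rewrite divr_gt0. Qed.

Let continuous_at_log_integrand (x : R) : 0 < x ->
  continuous_at x (log_integrand q).
Proof.
move=> x0.
have cadd1 (g : R -> R) : continuous_at x g -> continuous_at x (fun y => g y + 1).
  by move=> cg; apply: cvgD => //; exact: cvg_cst.
have cp (r : R) : continuous_at x (fun y => y `^ r + 1).
  exact/cadd1/continuous_at_powR.
have p0 (r : R) : 0 < x `^ r + 1 by rewrite ltr_wpDl ?powR_ge0.
apply: continuous_atM; last by apply: cvgV; [exact: lt0r_neq0|exact: cp].
apply: continuous_atM; first exact: cp.
apply: (@continuous_comp _ _ _ (fun y : R => y `^ q + 1) (@ln R)); first exact: cp.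
by apply: continuous_ln.
Qed.

Let log_integrand_bound (x : R) : 0 <= x <= 1 -> 0 <= log_integrand q x <= 2.
Proof.
move=> /andP[]; rewrite le_eqVlt => /predU1P[<-|x0] x1.
  (* At [x = 0] the logarithm is [ln 1 = 0], whatever the first factor is. *)
  rewrite /log_integrand (powR0 (lt0r_neq0 q0)) add0r ln1 mulr0 mul0r lexx.
  by rewrite ler0n.
have p0 (r : R) : 0 <= x `^ r by exact: powR_ge0.
have ln0 : 0 <= ln (x `^ q + 1) by rewrite ln_ge0// lerDr.
have d0 : 0 < x `^ (3 * q) + 1 by rewrite ltr_wpDl.
rewrite /log_integrand; apply/andP; split.
  by apply: divr_ge0; [rewrite mulr_ge0// addr_ge0|exact: ltW].
rewrite ler_pdivrMr//; apply: (@le_trans _ _ ((x `^ (3 * q - 2) + 1) * x `^ q)).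
  rewrite ler_wpM2l ?addr_ge0// addrC le_ln1Dx//.
  by rewrite (lt_le_trans _ (p0 _))// ltrN10.
have le1 (r : R) : 0 <= r -> x `^ r <= 1.
  by move=> r0; rewrite -[leRHS](powRr0 x) ger_powR// x0.
rewrite mulrDl mul1r -powRD; last by rewrite (lt0r_neq0 x0) implybT.
have h1 : x `^ (3 * q - 2 + q) <= 1 by apply: le1; move: q_gt; lra.
have h2 : x `^ q <= 1 by apply: le1; exact: ltW.
have := p0 (3 * q); lra.
Qed.

Lemma integrable_log_integrand :
  mu.-integrable `[0, 1] (EFin \o log_integrand q).
Proof.
have i2 : mu.-integrable `[0, 1] (EFin \o (fun=> 2 : R)).
  apply: continuous_compact_integrable; first exact: segment_compact.
  by apply: continuous_subspaceT => x; exact: cvg_cst.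
apply: le_integrable i2 => //.
  apply/measurable_EFinP/measurable_fun_itv_obnd_cbndP.
  apply: measurable_fun_gt0 => //.
  by move=> t /=; rewrite !in_itv/= => /andP[->].
move=> x /=; rewrite in_itv/= => x01; rewrite lee_fin.
by have /andP[? ?] := log_integrand_bound x01; rewrite !ger0_norm.
Qed.

Lemma integral_log_integrand_powR (f := fun t : R =>
    (t `^ (2 - 1 / q) + t `^ (1 / q - 1)) * ln (1 + t) / (1 + t ^+ 3)) :
  mu.-integrable Runit (EFin \o f) /\
  \int[mu]_(t in Runit) f t = q * \int[mu]_(x in `[0, 1]) log_integrand q x.
Proof.
have i0 : mu.-integrable Runit (EFin \o log_integrand q).
  apply: integrableS integrable_log_integrand => //.
  exact: subset_itv_oc_cc.
have cf (t : R) : 0 < t -> continuous_at t f.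
  move=> t0; apply: continuous_atM; last exact: continuous_at_inv1Dcube.
  apply: continuous_atM; first by apply: cvgD; exact: continuous_at_powR.
  by apply: (@continuous_at1D _ (@ln R)); apply: continuous_ln; rewrite addr_gt0.
have f0 (t : R) : 0 < t -> 0 <= f t.
  move=> t0; rewrite divr_ge0 ?mulr_ge0 ?addr_ge0 ?powR_ge0 ?exprn_ge0 ?(ltW t0)//.
  by rewrite ln_ge0// lerDl ltW.
(* As [f] is nonnegative, the extended equality with a real number gives both its integrability and
   the value of its integral. *)
suff fE : (\int[mu]_(t in Runit) (f t)%:E =
    (q * \int[mu]_(x in `[0, 1]) log_integrand q x)%:E)%E.
  split; last by rewrite /Rintegral fE.
  apply: ge0_integrable_fin fE => //.
    by apply: measurable_fun_gt0 => // t /=; rewrite !in_itv/= => /andP[->].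
  by move=> t /=; rewrite in_itv/= => /andP[t0 _]; exact: f0.
rewrite (ge0_integral_powR cf f0 q0) -Rintegral_itv_obnd_cbnd//.
rewrite -RintegralZl// -(integrable_EFin_Rintegral (mu := mu) (measurable_itv _)).
  apply: eq_integral => x /set_mem/=; rewrite in_itv/= => /andP[x0 _].
  congr EFin; rewrite /f /log_integrand [1 + x `^ q]addrC.
  have -> : (x `^ q) ^+ 3 = x `^ (3 * q).
    by rewrite -powR_mulrn ?powR_ge0// -powRrM mulrC.
  have e1 : (x `^ q) `^ (2 - 1 / q) * x `^ (q - 1) = x `^ (3 * q - 2).
    rewrite -powRrM -powRD; last by rewrite (lt0r_neq0 x0) implybT.
    by congr powR; field; exact: lt0r_neq0.
  have e2 : (x `^ q) `^ (1 / q - 1) * x `^ (q - 1) = 1.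
    rewrite -powRrM -powRD; last by rewrite (lt0r_neq0 x0) implybT.
    rewrite (_ : q * (1 / q - 1) + (q - 1) = 0) ?powRr0//.
    by field; exact: lt0r_neq0.
  have -> : x `^ (3 * q - 2) + 1 =
      ((x `^ q) `^ (2 - 1 / q) + (x `^ q) `^ (1 / q - 1)) * x `^ (q - 1).
    by rewrite [RHS]mulrDl e1 e2.
  rewrite [1 + _]addrC; ring.
have -> : EFin \o (fun x => q * log_integrand q x) = (fun x => q%:E * (EFin \o log_integrand q) x)%E.
  by apply/funext => x /=; rewrite EFinM.
exact: integrableZl.
Qed.

End log_integrand.

Theorem theorem2p9 (R : realType) (q : R) (hq : 1 / 2 < q) :
  [/\ (@lebesgue_measure R).-integrable `[0, 1] (EFin \o log_integrand q),
      cvgn (series (gamma_psi_term q)) &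
      \int[@lebesgue_measure R]_(x in `[0, 1]) log_integrand q x =
        1 / (36 * q) * (trigamma ((6 * q - 1) / (6 * q))
                        - trigamma ((3 * q - 1) / (6 * q)))
        + 1 / q * limn (series (gamma_psi_term q))].
Proof.
have q0 : 0 < q by apply: lt_trans hq; rewrite divr_gt0.
have s0 : 0 < 1 / q by rewrite divr_gt0.
have s2 : 1 / q < 2.
  by rewrite ltr_pdivrMr// mulrC -ltr_pdivrMr.
have [fi fE] := integral_log_integrand_powR hq.
have c := cvg_log_integral_series s0 s2 fi.
split; first exact: integrable_log_integrand.
  by apply/cvg_ex; eexists; exact: c.
rewrite (cvg_lim _ c)// fE.
rewrite (_ : (6 * q - 1) / (6 * q) = (6 - 1 / q) / 6); last by field; exact: lt0r_neq0.
rewrite (_ : (3 * q - 1) / (6 * q) = (3 - 1 / q) / 6); last by field; exact: lt0r_neq0.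
move: (trigamma _) (trigamma _) (\int[_]_(_ in _) _) => a b I.
by field; exact: lt0r_neq0.
Qed.
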